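(* Let $(G,\tau)$ be an infinite Hausdorff $SD$-paratopological group. Then there does not exist a Hausdorff paratopological group topology $\sigma$ on $G$ such that $\sigma$ and $\tau$ are $T_1$-complementary.
   Context: A paratopological group is a group with a topology for which multiplication $G\times G\to G$ is jointly continuous; such a topology is called a paratopological group topology on $G$. Let $e$ be the identity. A paratopological group is saturated if for every neighborhood $U$ of $e$ the set $U^{-1}$ has nonempty interior. A paratopological group $(G,\tau)$ is an $SD$-paratopological group if there exists a saturated paratopological group topology $\gamma$ on $G$ which is weaker than (i.e. contained in, possibly equal to) $\tau$ such that every dense subset of $(G,\gamma)$ is dense in $(G,\tau)$. Two $T_1$ topologies $\tau_1,\tau_2$ on a set $X$ are $T_1$-complementary if $\tau_1\cap\tau_2$ is the cofinite topology on $X$ and their supremum (the topology generated by $\tau_1\cup\tau_2$) is the discrete topology on $X$. *)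

(* Defs.v *)
From HB Require Import structures.
From mathcomp Require Import all_boot.
From mathcomp Require Import all_classical topology.

Set Implicit Arguments.
Unset Strict Implicit.
Unset Printing Implicit Defensive.

Local Open Scope classical_set_scope.
Local Open Scope group_scope.

(* Several topologies on one group [G] are compared, so a topology is a
   structure [t : Topological G] on the carrier (as in [sup_topology]) rather
   than a canonical instance; [withTop t] is the space [(G, t)]. Its carrier
   is convertible to [G]. *)
Definition withTop (T : Type) (t : Topological T) : topologicalType :=
  Topological.Pack t.

Definition opens (T : Type) (t : Topological T) : set (set T) :=
  @open (withTop t).

Definition paratopological_group (G : groupType) (t : Topological G) : Prop :=
  continuous (fun p : withTop t * withTop t =>
    ((p.1 : G) * (p.2 : G) : withTop t)).

(* Only used for paratopological groups [(G, t)]. *)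
Definition saturated (G : groupType) (t : Topological G) : Prop :=
  forall U : set (withTop t), nbhs ((1 : G) : withTop t) U ->
    interior ([set (x : G)^-1 | x in U] : set (withTop t)) !=set0.

Definition SD_paratopological_group (G : groupType) (t : Topological G) :
    Prop :=
  paratopological_group t /\
  exists g : Topological G,
    [/\ paratopological_group g,
        saturated g,
        opens g `<=` opens t &
        forall D : set G, @dense (withTop g) D -> @dense (withTop t) D].

Definition cofinite_opens (T : Type) : set (set T) :=
  [set A | A = set0 \/ cofinite_set A].

Definition T1_complementary (T : choiceType) (t1 t2 : Topological T) : Prop :=
  [/\ @accessible_space (withTop t1),
      @accessible_space (withTop t2),
      opens t1 `&` opens t2 = cofinite_opens (T := T) &
      forall A : set (sup_topology (fun b : bool => if b then t1 else t2)),
        open A].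

(* Main.v *)
(** Products [U * V] of a nonempty tau-open and a nonempty sigma-open set are
    unions of translates of [U] and of [V], hence open in both topologies, hence
    cofinite. The SD property makes [tau] itself saturated, so inverses of
    nonempty tau-open sets contain nonempty tau-open sets, and products in which
    [U] or [V] is replaced by its inverse are cofinite as well. As the supremum
    is discrete, [U] and [V] meet only in [1] for suitable neighbourhoods of
    [1]. Take [V1] with [V1 * V1] inside [V], and nonempty tau-open [A], [B]
    with [A * B] inside [U] minus [1]. The cofinite sets [V1^-1 * A] and
    [V1 * B^-1] share a point [v^-1 * a = w * b^-1], and then [a * b = v * w]
    lies in both [U] and [V] without being [1]. *)

Require Import Defs.
From HB Require Import structures.
From mathcomp Require Import all_boot.
From mathcomp Require Import all_classical topology.

Set Implicit Arguments.
Unset Strict Implicit.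
Unset Printing Implicit Defensive.

Local Open Scope classical_set_scope.
Local Open Scope group_scope.

Lemma cofinite_setI_neq0 (T : Type) (A B : set T) : infinite_set [set: T] ->
  cofinite_set A -> cofinite_set B -> (A `&` B) !=set0.
Proof.
move=> Tinf cA cB; apply: contra_notP Tinf => /set0P/negP/negPn/eqP AB0.
by rewrite -setC0 -AB0 setCI finite_setU.
Qed.

Lemma cofinite_invg (G : groupType) (A : set G) :
  cofinite_set A -> cofinite_set [set x | A x^-1].
Proof.
move=> /(finite_image (fun x : G => x^-1)); apply: sub_finite_set => x nAx.
by exists x^-1; rewrite ?invgK.
Qed.

Section Opens.
Variables (G : groupType) (t : Topological G).

Lemma opens_nbhsP (W : set G) :
  opens t W <-> forall x, W x -> exists A, [/\ opens t A, A x & A `<=` W].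
Proof.
split=> [oW x Wx|W_nbhs]; first by exists W; split.
rewrite /opens openE => x /W_nbhs[A [oA Ax AW]].
by rewrite /interior nbhsE; exists A.
Qed.

Hypothesis t_mul : paratopological_group t.

Lemma opens_mulg (W : set G) (x y : G) : opens t W -> W (x * y) ->
  exists A B, [/\ opens t A, opens t B, A x, B y &
    forall a b, A a -> B b -> W (a * b)].
Proof.
move=> oW Wxy.
have nW : nbhs ((x * y) : withTop t) W by exact: open_nbhs_nbhs.
have [[P Q]] := @t_mul (x, y) W nW.
move=> [/= nP nQ] PQW; move: nP nQ.
rewrite !(@nbhsE (withTop t)) => -[A [oA Ax] AP] [B [oB By] BQ].
exists A, B; split=> // a b Aa Bb.
by apply: (PQW (a, b)); split; [exact: AP|exact: BQ].
Qed.

Lemma opens_lmulg (W : set G) (a : G) :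
  opens t W -> opens t [set x | W (a * x)].
Proof.
move=> oW; apply/opens_nbhsP => x /(opens_mulg oW)[A [B [_ oB Aa Bx ABW]]].
by exists B; split=> // y By; exact: ABW.
Qed.

Lemma opens_rmulg (W : set G) (a : G) :
  opens t W -> opens t [set x | W (x * a)].
Proof.
move=> oW; apply/opens_nbhsP => x /(opens_mulg oW)[A [B [oA _ Ax Ba ABW]]].
by exists A; split=> // y Ay; exact: ABW.
Qed.

Lemma opens_set_mull (U V : set G) : opens t U ->
  opens t [set u * v | u in U & v in V].
Proof.
move=> oU; apply/opens_nbhsP => _ [u Uu [v Vv <-]].
exists [set x | U (x * v^-1)]; split; first exact: opens_rmulg.
  by rewrite /= mulgK.
by move=> x Ux; exists (x * v^-1) => //; exists v; rewrite ?mulgVK.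
Qed.

Lemma opens_set_mulr (U V : set G) : opens t V ->
  opens t [set u * v | u in U & v in V].
Proof.
move=> oV; apply/opens_nbhsP => _ [u Uu [v Vv <-]].
exists [set x | V (u^-1 * x)]; split; first exact: opens_lmulg.
  by rewrite /= mulKg.
by move=> x Vx; exists u => //; exists (u^-1 * x); rewrite ?mulVKg.
Qed.

End Opens.

Lemma cofinite_set_mulg (G : groupType) (t1 t2 : Topological G) (U V : set G) :
  paratopological_group t1 -> paratopological_group t2 ->
  opens t1 `&` opens t2 = cofinite_opens (T := G) ->
  opens t1 U -> opens t2 V -> U !=set0 -> V !=set0 ->
  cofinite_set [set u * v | u in U & v in V].
Proof.
move=> t1_mul t2_mul t12 oU oV [u Uu] [v Vv].
have : (opens t1 `&` opens t2) [set u * v | u in U & v in V].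
  by split; [exact: opens_set_mull|exact: opens_set_mulr].
rewrite t12 => -[UV0|//]; suff : @set0 G (u * v) by [].
by rewrite -UV0; exists u => //; exists v.
Qed.

Lemma SD_opens_invg (G : groupType) (t : Topological G) (U : set G) :
  SD_paratopological_group t -> opens t U -> U !=set0 ->
  exists W, [/\ opens t W, W !=set0 & forall x, W x -> U x^-1].
Proof.
move=> [_ [g [g_mul g_sat gt g_dense]]] oU [u Uu].
(* Otherwise the complement of [U] would be g-dense, hence t-dense. *)
have [O [oO [o Oo] OU]] : exists O, [/\ opens g O, O !=set0 & O `<=` U].
  apply: contrapT => noO.
  have /g_dense/(_ U) : @dense (withTop g) (~` U).
    move=> O O0 oO; apply: contrapT => OU0; apply: noO; exists O; split=> //.
    move=> x Ox; apply: contrapT => nUx; apply: OU0.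
    by exists x.
  by case=> [|//|x []//]; exists u.
(* Saturation concerns neighbourhoods of [1], so it is applied to [o^-1 * O]. It yields a nonempty
   g-open [W] inside [O^-1 * o], and then [W * o^-1] lies inside [O^-1]. *)
have nN : nbhs ((1 : G) : withTop g) [set x | O (o * x)].
  by apply: open_nbhs_nbhs; split; [exact: opens_lmulg|rewrite /= mulg1].
have [x] := g_sat _ nN; rewrite /interior nbhsE => -[W [oW Wx] WN].
exists [set y | W (y * o)]; split.
- by apply: gt; exact: opens_rmulg.
- by exists (x * o^-1); rewrite /= mulgVK.
- move=> y /WN[z Oz zE]; apply: OU.
  by rewrite -[y^-1](mulVKg o) -invgM -zE invgK.
Qed.

(** The filter [F] of supersets of the sets [U] [&] [V] converges to [x] in both topologies, hence
    in their supremum. There the singleton of [x] is open, so it belongs to [F]. *)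
Lemma sup_discrete_separated (T : choiceType) (t1 t2 : Topological T) (x : T) :
  (forall A : set (sup_topology (fun b : bool => if b then t1 else t2)),
    open A) ->
  exists U V, [/\ opens t1 U, opens t2 V, U x, V x & U `&` V `<=` [set x]].
Proof.
move=> disc.
pose F : set_system T := [set A | exists U V,
  [/\ opens t1 U, opens t2 V, U x, V x & U `&` V `<=` A]].
have F_filter : Filter F.
  split.
  - by exists setT, setT; split=> //; exact: openT.
  - move=> A B [U [V [oU oV Ux Vx UVA]]] [U' [V' [oU' oV' Ux' Vx' UVB]]].
    exists (U `&` U'), (V `&` V'); split=> //; try exact: openI.
    by move=> y [[? ?] [? ?]]; split; [exact: UVA|exact: UVB].
  - move=> A B AB [U [V [oU oV Ux Vx UVA]]].
    by exists U, V; split=> // y /UVA/AB.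
pose S := sup_topology (fun b : bool => if b then t1 else t2).
suff : F --> (x : S) by apply; apply: open_nbhs_nbhs; split=> //; exact: disc.
apply/cvg_sup => -[] A.
- rewrite /= (@nbhsE (withTop t1)) => -[B [oB Bx] BA].
  exists B, setT; split=> //; first exact: openT.
  by move=> y [/BA].
- rewrite /= (@nbhsE (withTop t2)) => -[B [oB Bx] BA].
  exists setT, B; split=> //; first exact: openT.
  by move=> y [_ /BA].
Qed.

Theorem theorem3p3 (G : groupType) (tau : Topological G)
    (G_infinite : infinite_set [set: G])
    (tau_hausdorff : hausdorff_space (withTop tau))
    (tau_SD : SD_paratopological_group tau) :
  ~ exists sigma : Topological G,
      [/\ hausdorff_space (withTop sigma),
          paratopological_group sigma &
          T1_complementary sigma tau].
Proof.
move=> [sigma [sigma_T2 sigma_mul [_ tau_T1 st disc]]].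
have [tau_mul _] := tau_SD.
have ts : opens tau `&` opens sigma = cofinite_opens (T := G) by rewrite setIC.
have [V [U [oV oU V1 U1 VU]]] := sup_discrete_separated 1 disc.
(* If [U] were trivial, [U * W] would lie in [W], so every nonempty sigma-open [W] would be
   cofinite. Two such sets always meet in an infinite group, against the Hausdorff property of
   [sigma]. *)
have [a Ua a1] : exists2 a, U a & a != 1.
  apply: contrapT => noa.
  have cofV W : opens sigma W -> W !=set0 -> cofinite_set W.
    move=> oW W0; apply: sub_cofinite_set
      (cofinite_set_mulg tau_mul sigma_mul ts oU oW (ex_intro _ 1 U1) W0).
    move=> _ [u Uu [w Ww <-]]; have [->|u1] := eqVneq u 1.
      by rewrite mul1g.
    by case: noa; exists u.
  have [b [_ b1]] : ([set: G] `\` [set 1]) !=set0.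
    by apply: infinite_setN0; exact: infinite_setD.
  move: sigma_T2; rewrite open_hausdorff => /(_ b (1 : G))[|[P Q]].
    by apply/eqP => /b1.
  move=> /= [/set_mem Pb /set_mem Q1] [oP oQ /eqP PQ0].
  have : (P `&` Q) !=set0.
    by apply: cofinite_setI_neq0 => //; apply: cofV => //; [exists b|exists 1].
  by rewrite PQ0 => -[].
(* Multiplication is continuous at [(1, a)], and [U] minus [1] is a tau-open set containing
   [1 * a]. *)
have [A [B [oA oB A1 Ba AB]]] : exists A B, [/\ opens tau A, opens tau B,
    A 1, B a & forall x y, A x -> B y -> (U `\` [set 1]) (x * y)].
  apply: opens_mulg => //; last by rewrite mul1g; split=> //; exact/eqP.
  rewrite /opens setDE; apply: openI => //; apply: closed_openC.
  exact: accessible_closed_set1.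
have [V2 [V3 [oV2 oV3 V21 V31 VV]]] : exists V2 V3, [/\ opens sigma V2,
    opens sigma V3, V2 1, V3 1 & forall x y, V2 x -> V3 y -> V (x * y)].
  by apply: opens_mulg; rewrite ?mulg1.
have [A' [oA' A'0 A'A]] := SD_opens_invg tau_SD oA (ex_intro _ 1 A1).
have [B' [oB' B'0 B'B]] := SD_opens_invg tau_SD oB (ex_intro _ a Ba).
(* [V2^-1] need not be sigma-open, so the cofinite product [A' * V2] is formed first and then
   inverted, which gives [V2^-1 * A'^-1] with [A'^-1] inside [A]. *)
have /cofinite_invg c1 := cofinite_set_mulg tau_mul sigma_mul ts oA' oV2 A'0
  (ex_intro _ 1 V21).
have c2 := cofinite_set_mulg sigma_mul tau_mul st oV3 oB'
  (ex_intro _ 1 V31) B'0.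
have [x [[p /A'A Ap [v Vv pvx]] [w Ww [q /B'B Bq wqx]]]] :=
  cofinite_setI_neq0 G_infinite c1 c2.
(* The common point is [x = v^-1 * p^-1 = w * q], with [p^-1] in [A] and [q^-1] in [B]. *)
have pq : p^-1 * q^-1 = v * w.
  by rewrite -(mulgK q w) wqx -[x]invgK -pvx invgM !mulgA mulgV mul1g.
have [Upq] := AB _ _ Ap Bq; apply; apply: VU; split=> //.
by rewrite pq; exact: VV.
Qed.
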